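(* Let $\phi:[0,1]\to[0,\infty)$ be a (measurable) weighting function such that $\phi(u)\le K$ for all $u\in[0,1]$. Let $X$ and $Y$ be random variables with CDFs $F_X$ and $F_Y$, respectively, for which the spectral risk measures $M_\phi(X)$ and $M_\phi(Y)$ are well defined and finite. Then $$|M_\phi(X)-M_\phi(Y)|\le K\,W_1(F_X,F_Y).$$
   Context: For a CDF $F$ on $\mathbb{R}$, the generalized inverse is $F^{-1}(\beta)=\inf\{x\in\mathbb{R}:F(x)\ge\beta\}$. The spectral risk measure associated with $\phi$ is $M_\phi(X)=\int_0^1\phi(\beta)F_X^{-1}(\beta)\,d\beta$, where $F_X$ is the CDF of $X$. $W_1$ is the 1-Wasserstein distance between CDFs on $\mathbb{R}$: $W_1(F_1,F_2)=\inf\int_{\mathbb{R}^2}|x-y|\,dF(x,y)$ over joint distributions $F$ with marginals $F_1,F_2$ (possibly $+\infty$); equivalently $W_1(F_1,F_2)=\int_{-\infty}^{\infty}|F_1(s)-F_2(s)|\,ds=\int_0^1|F_1^{-1}(\beta)-F_2^{-1}(\beta)|\,d\beta$. *)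

(* Defs.v *)
From HB Require Import structures.
From mathcomp Require Import all_boot all_order all_algebra.
From mathcomp Require Import all_classical all_reals all_analysis.

Set Implicit Arguments.
Unset Strict Implicit.
Unset Printing Implicit Defensive.

Import Order.TTheory GRing.Theory Num.Theory.
Import numFieldNormedType.Exports.

Local Open Scope classical_set_scope.
Local Open Scope ring_scope.
Local Open Scope ereal_scope.

(* Extended-real valued, because the infimum is -oo at b = 0 and may be +oo at
   b = 1; on ]0, 1[ it is finite when F is a CDF.  The library's CDFs take
   values in \bar R, hence the type of F. *)
Definition ginv (R : realType) (F : R -> \bar R) (b : R) : \bar R :=
  ereal_inf [set x%:E | x in [set x : R | b%:E <= F x]].

Definition spectral_integrand (R : realType) (phi : R -> R) (F : R -> \bar R)
  (b : R) : \bar R := (phi b)%:E * ginv F b.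

Definition spectral_risk (R : realType) (phi : R -> R) d (T : measurableType d)
    (P : probability T R) (X : {RV P >-> R}) : \bar R :=
  \int[lebesgue_measure]_(b in `[0%R, 1%R]) spectral_integrand phi (cdf X) b.

(* "Well defined and finite": the Lebesgue integral defining the risk measure
   converges absolutely, i.e. its positive and negative parts are both
   finite. *)
Definition spectral_risk_finite (R : realType) (phi : R -> R) d
    (T : measurableType d) (P : probability T R) (X : {RV P >-> R}) : Prop :=
  lebesgue_measure.-integrable `[0%R, 1%R]
    (spectral_integrand phi (cdf X)).

(* A joint distribution on the plane, as a Borel probability measure, whose
   two marginal CDFs are F1 and F2. *)
Definition coupling (R : realType) (F1 F2 : R -> \bar R)
    (J : probability (R * R)%type R) : Prop :=
  (forall x : R, J (`]-oo, x] `*` [set: R]) = F1 x) /\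
  (forall y : R, J ([set: R] `*` `]-oo, y]) = F2 y).

Definition wasserstein1 (R : realType) (F1 F2 : R -> \bar R) : \bar R :=
  ereal_inf [set \int[J]_z (`|z.1 - z.2|%R)%:E |
             J in [set J : probability (R * R)%type R | coupling F1 F2 J]].

(* Main.v *)
(** For 0 < b < 1, right continuity of a CDF F gives b <= F s iff F^-1 b <= s,
    so the region between the graphs of F and G, cut at height b, is an
    interval of length |F^-1 b - G^-1 b|, and cut at abscissa s it has length
    |F s - G s|.  Since F s and G s are the masses under a coupling J of the
    half-planes x <= s and y <= s, |F s - G s| is at most the J-mass of their
    symmetric difference, and integrating this in s gives the J-integral of
    |x - y|, as {s | x <= s} and {s | y <= s} differ by a set of measure
    |x - y|.  Two uses of Tonelli thus bound the integral of |F^-1 - G^-1| by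
    the cost of every coupling, and 0 <= phi <= K yields the factor K. *)

Require Import Defs.
From HB Require Import structures.
From mathcomp Require Import all_boot all_order all_algebra.
From mathcomp Require Import all_classical all_reals all_analysis.
From mathcomp Require Import measurable_realfun.

Import Order.TTheory GRing.Theory Num.Theory.
Import numFieldNormedType.Exports.

Local Open Scope classical_set_scope.
Local Open Scope ring_scope.
Local Open Scope ereal_scope.

(** By symmetry [x <= y], and then the symmetric difference is the interval [[x, y[]. It serves
    twice: for the cut at height [b] and for the pair [(x, y)] drawn from a coupling. *)
Lemma lebesgue_measure_setY_ge (R : realType) (x y : R) :
  lebesgue_measure ([set s : R | (x <= s)%R] `+` [set s : R | (y <= s)%R]) =
  `|x - y|%:E.
Proof.
wlog xy : x y / (x <= y)%R => [H|].
  by have [/H//|/ltW/H] := leP x y; rewrite setYC distrC.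
have -> : [set s : R | (x <= s)%R] `+` [set s : R | (y <= s)%R] = `[x, y[%classic.
  rewrite setY_def; apply/seteqP; split => s /=; rewrite in_itv/=.
    move=> [[-> /negP]|[/(le_trans xy) ? //]].
    by rewrite -ltNge.
  by move=> /andP[xs sy]; left; split => //; apply/negP; rewrite -ltNge.
rewrite lebesgue_measure_itv/= lte_fin ler0_norm ?subr_le0// opprB EFinB.
by case: ltgtP xy => // -> _; rewrite subee.
Qed.

Lemma lebesgue_measure_setY_le (R : realType) (x y : R) :
  lebesgue_measure ([set s : R | (s <= x)%R] `+` [set s : R | (s <= y)%R]) =
  `|x - y|%:E.
Proof.
wlog xy : x y / (x <= y)%R => [H|].
  by have [/H//|/ltW/H] := leP x y; rewrite setYC distrC.
have -> : [set s : R | (s <= x)%R] `+` [set s : R | (s <= y)%R] = `]x, y]%classic.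
  rewrite setY_def; apply/seteqP; split => s /=; rewrite in_itv/=.
    move=> [[/le_trans/(_ xy) ? //]|[-> /negP]].
    by rewrite -ltNge => ->.
  by move=> /andP[xs sy]; right; split => //; apply/negP; rewrite -ltNge.
rewrite lebesgue_measure_itv/= lte_fin ler0_norm ?subr_le0// opprB EFinB.
by case: ltgtP xy => // -> _; rewrite subee.
Qed.

Lemma measurable_setY d (T : measurableType d) (A B : set T) :
  measurable A -> measurable B -> measurable (A `+` B).
Proof. by move=> mA mB; rewrite setY_def; apply: measurableU; exact: measurableD. Qed.

(** Each of [A], [B] is contained in the union of the other with [A]+[B], so subadditivity bounds
    both [a - b] and [b - a]. *)
Lemma measure_setY_ge d (T : measurableType d) (R : realType)
    (P : probability T R) (A B : set T) (a b : R) :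
  measurable A -> measurable B -> P A = a%:E -> P B = b%:E ->
  `|a - b|%:E <= P (A `+` B).
Proof.
move=> mA mB.
have mAB := measurable_setY _ _ _ _ mA mB.
have le_add (C D : set T) : measurable C -> measurable D -> C `<=` D `|` (A `+` B) ->
    P C <= P D + P (A `+` B).
  move=> mC mD CD; apply: (le_trans (le_measure P _ _ CD)); rewrite ?inE//.
    exact: measurableU.
  exact: measureU2.
have := le_add A B mA mB; have := le_add B A mB mA.
have /fineK <- : P (A `+` B) \is a fin_num by exact: fin_num_measure.
move=> BA AB PA PB.
rewrite PA PB -!EFinD !lee_fin in BA AB *.
have {}BA : (b <= a + fine (P (A `+` B)))%R.
  by apply: BA => t Bt; rewrite setY_def; have [At|nAt] := pselect (A t); [left|right; right].
have {}AB : (a <= b + fine (P (A `+` B)))%R.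
  by apply: AB => t At; rewrite setY_def; have [Bt|nBt] := pselect (B t); [left|right; left].
by rewrite ler_norml lerBlDl AB andbT lerBrDl lerBlDr.
Qed.

(** Both sides are the integral of the indicator of [A], taken in the two orders. *)
Lemma tonelli_section d1 d2 (T1 : measurableType d1) (T2 : measurableType d2)
    (R : realType) (m1 : {sigma_finite_measure set T1 -> \bar R})
    (m2 : {sigma_finite_measure set T2 -> \bar R}) (A : set (T1 * T2)) :
  measurable A ->
  \int[m1]_x m2 (xsection A x) = \int[m2]_y m1 (ysection A y).
Proof.
move=> mA; have := indic_fubini_tonelli m1 m2 mA.
by rewrite indic_fubini_tonelli_FE// indic_fubini_tonelli_GE.
Qed.

Lemma xsection_set d1 d2 (T1 : measurableType d1) (T2 : measurableType d2)
    (A : set (T1 * T2)) x : xsection A x = [set y | A (x, y)].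
Proof. by apply/seteqP; split => y; rewrite /xsection/= inE. Qed.

Lemma ysection_set d1 d2 (T1 : measurableType d1) (T2 : measurableType d2)
    (A : set (T1 * T2)) y : ysection A y = [set x | A (x, y)].
Proof. by apply/seteqP; split => x; rewrite /ysection/= inE. Qed.

(** The limits 1 and 0 of the CDF at [+oo] and [-oo] make the superlevel set [S] nonempty and
    bounded below, so its infimum is real; right continuity puts the infimum in [S]. *)
Lemma ginv_cdfP d (T : measurableType d) (R : realType) (P : probability T R)
    (X : {RV P >-> R}) (b : R) : (0 < b < 1)%R ->
  exists2 x : R, ginv (cdf X) b = x%:E &
    forall s, (b%:E <= cdf X s) = (x <= s)%R.
Proof.
move=> /andP[b0 b1].
pose S := [set x : R | b%:E <= cdf X x].
have S0 : S !=set0.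
  have : \forall x \near +oo%R, b%:E < cdf X x.
    have /open_ereal_gt'/(cvg_cdfy1 X) : b%:E < 1 by rewrite lte_fin.
    exact.
  by move=> /filter_ex[x /ltW bx]; exists x.
have [m mS] : exists m, lbound S m.
  have : \forall x \near -oo%R, cdf X x < b%:E.
    have /open_ereal_lt'/(cvg_cdfNy0 X) : 0 < b%:E by rewrite lte_fin.
    exact.
  move=> /filter_ex[x xb]; exists x => y; rewrite /S/= => bFy.
  rewrite leNgt; apply/negP => /ltW/(cdf_nondecreasing X) yx.
  by have := lt_le_trans xb (le_trans bFy yx); rewrite ltxx.
have hlS : has_lbound S by exists m.
exists (inf S) => [|s]; first exact: ereal_inf_EFin.
apply/idP/idP => [bs|]; first exact: ge_inf.
suff bS : b%:E <= cdf X (inf S) by move=> /(cdf_nondecreasing X); exact: le_trans.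
(* Otherwise the CDF stays below [b] at some [t > inf S], while [S] has a point [e < t], against
   monotonicity. *)
rewrite leNgt; apply/negP => Sb.
have cdf_lt : \forall t \near (inf S)^'+, cdf X t < b%:E.
  by move/open_ereal_lt' : Sb => /cdf_right_continuous.
have [t [tb St]] :=
  @filter_ex _ _ (at_right_proper_filter (inf S)) _ (filterI cdf_lt (nbhs_right_gt (inf S))).
have ts : (0 < t - inf S)%R by rewrite subr_gt0.
have [e Se] := inf_adherent ts (conj S0 hlS).
rewrite subrKC => /ltW/(cdf_nondecreasing X)/(le_trans Se).
by rewrite leNgt tb.
Qed.

(** The region between the two graphs, as pairs (height, abscissa). The inequalities are large so
    that cuts at height [b] are the half-lines of [ginv_cdfP]. *)
Definition quantile_gap (R : realType) (F G : R -> \bar R) : set (R * R) :=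
  [set z | z.1%:E <= F z.2] `+` [set z | z.1%:E <= G z.2].

Lemma measurable_quantile_gap (R : realType) (F G : R -> \bar R) :
  measurable_fun [set: R] F -> measurable_fun [set: R] G ->
  measurable (quantile_gap R F G).
Proof.
have mle (H : R -> \bar R) : measurable_fun [set: R] H ->
    measurable [set z : R * R | z.1%:E <= H z.2].
  move=> mH; rewrite -[X in measurable X]setTI; apply: measurable_lee => //.
    by apply/measurable_EFinP; exact: measurable_fst.
  by apply: measurableT_comp.
by move=> mF mG; apply: measurable_setY; exact: mle.
Qed.

(** Letting [b] range over the whole line costs nothing: [F] and [G] take values in [[0, 1]], so
    cuts at heights [b <= 0] or [b > 1] are empty. *)
Lemma quantile_gap_le_coupling (R : realType) (F G : R -> \bar R)
    (J : probability (R * R)%type R) :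
  measurable_fun [set: R] F -> measurable_fun [set: R] G -> coupling F G J ->
  \int[lebesgue_measure]_b lebesgue_measure (xsection (quantile_gap R F G) b) <=
  \int[J]_z `|z.1 - z.2|%:E.
Proof.
move=> mF mG [JF JG].
have mA := measurable_quantile_gap R F G mF mG.
(* In the space of triples [((x, y), s)], fixing [(x, y)] gives half-lines in [s], and fixing [s]
   gives the half-planes whose [J]-masses are [F s] and [G s]. *)
pose le1 := [set w : (R * R) * R | (w.1.1 <= w.2)%R].
pose le2 := [set w : (R * R) * R | (w.1.2 <= w.2)%R].
have mB : measurable (le1 `+` le2).
  apply: measurable_setY; rewrite -[X in measurable X]setTI;
    apply: measurable_fun_le => //; apply: measurableT_comp => //.
rewrite (eq_integral (fun z => lebesgue_measure (xsection (le1 `+` le2) z))); last first.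
  by move=> [x y] _; rewrite xsection_set; exact/esym/lebesgue_measure_setY_ge.
rewrite !tonelli_section//.
apply: ge0_le_integral => //.
- exact: measurable_fun_ysection.
- exact: measurable_fun_ysection.
move=> s _; rewrite !ysection_set.
have mx : measurable [set z : R * R | (z.1 <= s)%R].
  by rewrite -[X in measurable X]setTI; apply: measurable_fun_le.
have my : measurable [set z : R * R | (z.2 <= s)%R].
  by rewrite -[X in measurable X]setTI; apply: measurable_fun_le.
have Fs : J [set z : R * R | (z.1 <= s)%R] = F s.
  by rewrite -JF; congr (J _); apply/seteqP; split => z /=; rewrite in_itv/=; tauto.
have Gs : J [set z : R * R | (z.2 <= s)%R] = G s.
  by rewrite -JG; congr (J _); apply/seteqP; split => z /=; rewrite in_itv/=; tauto.
have /fineK Fu : F s \is a fin_num by rewrite -Fs fin_num_measure.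
have /fineK Gu : G s \is a fin_num by rewrite -Gs fin_num_measure.
apply: (@le_trans _ _ `|fine (F s) - fine (G s)|%:E); last first.
  by apply: measure_setY_ge => //; rewrite ?Fu ?Gu.
(* The heights [b] below [F s] and those below [G s] form two half-lines, so equality holds here. *)
rewrite -lebesgue_measure_setY_le le_eqVlt; apply/orP; left; apply/eqP.
by congr (lebesgue_measure (_ `+` _)); apply/funext => b /=;
  rewrite -lee_fin ?Fu ?Gu.
Qed.

Theorem lemma13 (R : realType) (phi : R -> R) (K : R)
    (mphi : measurable_fun (`[0%R, 1%R] : set R) phi)
    (phi_ge0 : forall u : R, (0 <= u <= 1)%R -> (0 <= phi u)%R)
    (phi_leK : forall u : R, (0 <= u <= 1)%R -> (phi u <= K)%R)
    (dX : measure_display) (TX : measurableType dX) (PX : probability TX R)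
    (X : {RV PX >-> R})
    (dY : measure_display) (TY : measurableType dY) (PY : probability TY R)
    (Y : {RV PY >-> R})
    (MX : spectral_risk_finite phi X) (MY : spectral_risk_finite phi Y) :
  `|spectral_risk phi X - spectral_risk phi Y|
    <= K%:E * wasserstein1 (cdf X) (cdf Y).
Proof.
have K0 : (0 <= K)%R by apply: (le_trans (phi_ge0 0%R _)); rewrite ?phi_leK ?lexx ?ler01.
pose gap b := lebesgue_measure (xsection (quantile_gap R (cdf X) (cdf Y)) b).
have mF := cdf_measurable X; have mG := cdf_measurable Y.
have mA := measurable_quantile_gap R _ _ mF mG.
have mgap : measurable_fun setT gap by exact: measurable_fun_xsection.
have mfg : measurable_fun (`[0%R, 1%R] : set R)
    (spectral_integrand phi (cdf X) \- spectral_integrand phi (cdf Y)).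
  by apply: emeasurable_funB; [exact: measurable_int MX|exact: measurable_int MY].
have sub01 : (`]0%R, 1%R[ : set R) `<=` `[0%R, 1%R].
  by apply: subset_itv; rewrite bnd_simp.
apply: (@le_trans _ _ (K%:E * \int[lebesgue_measure]_b gap b)); last first.
  rewrite lee_wpmul2l ?lee_fin//; apply/ereal_infP => _ [J FJ <-].
  exact: quantile_gap_le_coupling.
rewrite -integralB// -ge0_integralZl//.
apply: (le_trans (le_abse_integral _ _ _)) => //.
(* The endpoints form a null set; dropping them leaves only heights where both generalized inverses
   are finite. *)
rewrite integral_itv_bndoo; last first.
  by apply: measurableT_comp => //; exact: (measurable_funS _ sub01 mfg).
apply: (@le_trans _ _ (\int[lebesgue_measure]_(b in `]0%R, 1%R[) (K%:E * gap b))); last first.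
  apply: ge0_subset_integral => //; first exact: measurable_funeM.
  by move=> b _; rewrite mule_ge0// lee_fin.
apply: ge0_le_integral => //.
- by apply: measurableT_comp => //; exact: (measurable_funS _ sub01 mfg).
- by apply: measurable_funTS; exact: measurable_funeM.
move=> b; rewrite /= in_itv/= => b01.
have b01' : (0 <= b <= 1)%R by case/andP: b01 => /ltW -> /ltW ->.
rewrite /gap xsection_set /spectral_integrand.
have [x -> Fx] := ginv_cdfP _ _ _ _ X b b01.
have [y -> Gy] := ginv_cdfP _ _ _ _ Y b b01.
have -> : [set s | quantile_gap R (cdf X) (cdf Y) (b, s)] =
    [set s | (x <= s)%R] `+` [set s | (y <= s)%R].
  by congr (_ `+` _); apply/funext => s /=; rewrite ?Fx ?Gy.
rewrite lebesgue_measure_setY_ge -!EFinM -EFinB lee_fin -mulrBr normrM.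
by rewrite ler_wpM2r// ger0_norm ?phi_ge0// phi_leK.
Qed.
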